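(* Let $F$ be a field of characteristic not $2$ and let $A$ be a $(2,3)$-palintropic $F$-algebra with a nonzero idempotent $c$. Then the subalgebra $A_c(1)=\{x\in A: cx=x\}$ is power-associative.
   Context: Algebras are commutative, not necessarily associative, possibly infinite-dimensional; the base field has characteristic different from $2$ throughout. A commutative algebra is $(2,3)$-palintropic if $(x^3)^2-(x^2)^3=0$ for all $x$, where $x^2=xx$, $x^3=x(xx)$, $(x^3)^2=x^3x^3$, $(x^2)^3=x^2(x^2x^2)$. Power-associative: the subalgebra generated by any single element is associative. An idempotent is an element $c$ with $c^2=c$.
   Formalization: Over the field with 3 elements the identity (x^3)^2=(x^2)^3 is required as a polynomial identity (in A[[t]]), since with only the pointwise identity A_c(1) can fail to be a subalgebra; over all other fields the pointwise identity suffices. *)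

(* Defs.v *)
From HB Require Import structures.
From mathcomp Require Import all_boot all_order all_algebra.

Set Implicit Arguments.
Unset Strict Implicit.
Unset Printing Implicit Defensive.

Import GRing.Theory.
Local Open Scope ring_scope.

(* Powers and the identity make sense for any binary operation; besides the
   product of an algebra A, they are used for the product of A[[t]] below. *)
Section Powers.
Variables (T : Type) (mul : T -> T -> T).

Definition square (x : T) : T := mul x x.
Definition cube (x : T) : T := mul x (square x).

End Powers.

(* A non-associative F-algebra is a left F-module A with a bilinear product. *)
Section Algebras.
Variables (F : fieldType) (A : lmodType F) (mul : {bilinear A -> A -> A}).

Definition palintropic23 : Prop :=
  forall x : A, square mul (cube mul x) = cube mul (square mul x).

(* Product of A[[t]]; x : nat -> A stands for the series \sum_n t^n x_n. *)
Definition series_mul (x y : nat -> A) : nat -> A :=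
  fun n => \sum_(i < n.+1) mul (x i) (y (n - i)%N).

(* (2,3)-palintropy as a polynomial identity.  The coefficients of the identity
   at x_1 t^(e_1) + ... + x_k t^(e_k), for e_i growing fast enough, are all its
   partial linearizations, so this says that the identity holds in every scalar
   extension of A.  It implies [palintropic23] (take constant series).  The
   theorem needs it only over the field with 3 elements, where the pointwise
   identity does not make A_c(1) a subalgebra: take A with basis c, y, w and
   cc = c, cy = y, cw = y - w, yy = w, yw = w - y, ww = -y. *)
Definition strictly_palintropic23 : Prop :=
  forall x : nat -> A,
    square series_mul (cube series_mul x)
      =1 cube series_mul (square series_mul x).

Definition idempotent_elt (c : A) : Prop := mul c c = c.

(* The Peirce space A_c(1). *)
Definition peirce1 (c : A) : A -> Prop := fun x => mul c x = x.

Definition subalgebra (S : A -> Prop) : Prop :=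
  [/\ S 0,
      forall x y, S x -> S y -> S (x + y),
      forall (a : F) x, S x -> S (a *: x)
    & forall x y, S x -> S y -> S (mul x y)].

Definition generated (x : A) : A -> Prop :=
  fun y => forall S : A -> Prop, subalgebra S -> S x -> S y.

Definition associative_on (S : A -> Prop) : Prop :=
  forall u v w, S u -> S v -> S w -> mul u (mul v w) = mul (mul u v) w.

(* For a subalgebra S and x in S, the subalgebras generated by x in S and in A
   coincide. *)
Definition power_associative_on (S : A -> Prop) : Prop :=
  forall x, S x -> associative_on (generated x).

End Algebras.

(* Main.v *)
Require Import Defs.
From HB Require Import structures.
From mathcomp Require Import all_boot all_order all_algebra.
From mathcomp Require Import zify ring.
From Stdlib Require Import Classical_Prop.

Set Implicit Arguments.
Unset Strict Implicit.
Unset Printing Implicit Defensive.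

Import GRing.Theory.
Local Open Scope ring_scope.

(** Write f(x) = (x^3)^2 - (x^2)^3 and B = A_c(1), on which c acts as the
    identity.  The identities of degree below 6 that B satisfies are read off
    from f(c + u).

    - B is a subalgebra.  For x in B the part of f(c + x) of degree 2 in x is
      x^2 - c x^2 ([square_coef]), so B is closed under squares, hence under
      products since 2 is invertible ([peirce1_mul]).

    - B satisfies two smaller identities.  Once c is a unit for everything in
      sight, f(c + u) = 2 (u^2 u^2 - u u^3) + 2 (u^2 u^3 - u (u^2 u^2)) + f(u).
      Replacing u by -u separates the first bracket from the second, so both
      vanish ([quartic_quintic]).

    - These identities can be linearized.  If F has an element a other than
      0, 1 and -1, the four scalars 1, -1, a, -a suffice to isolate the lowest
      coefficient of a polynomial in t whose extreme coefficients are
      understood ([lowest_coef_eq]); this is exactly enough for degrees 4 and 5,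
      and for the degree 2 part above.  For degree 6 it would not be: over the
      field with 5 elements t^5 = t mixes the parts of degree 1 and 5, so f
      itself is never linearized.  If F = {0, 1, -1}, f vanishes
      in every scalar extension, in particular in the dual numbers A[t]/(t^2),
      and the previous item applied there has the linearized identities as its
      coefficients of t ([dual_quartic_quintic]).

    - Powers multiply correctly.  Let x^n be the principal powers, with x^0 = c.
      By induction on n, the defects d_k = x^k x^(n-k) - x^n vanish: the
      linearized identities evaluated at powers of x are linear relations with
      integer coefficients between the defects.  The cases n = 4 and n = 5 are
      the two identities themselves.  For n > 5 the relations give d_3 = 4 d_2,
      d_4 = 11 d_2 and 3 d_5 = 80 d_2 = 70 d_2.  Hence 10 d_2 = 0, which is
      inconclusive only in characteristic 5; there n = 6 is settled by f(x) = 0,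
      and n > 6 by two further relations ([defect2_eq0]).  Then a three-term
      recurrence kills the other d_k ([defect_eq0]).

    - So the span of the powers of x is an associative subalgebra containing
      x ([span_associative]), and it contains the subalgebra generated by x. *)

(** * Integer linear relations in an abelian group *)

(** The trivial extension of the integers by an abelian group V, in which V is
    an ideal of square zero.  It makes every identity between integer linear
    combinations in V an identity in a commutative ring, where it can be decided
    by normalization. *)
Definition null_ext (V : zmodType) : Type := (int * V)%type.

HB.instance Definition _ (V : zmodType) := GRing.Zmodule.on (null_ext V).

Section NullExtension.
Variable V : zmodType.

Definition null_mul (a b : null_ext V) : null_ext V :=
  (a.1 * b.1, b.2 *~ a.1 + a.2 *~ b.1).

Lemma null_mulA : associative null_mul.
Proof.
move=> [a x] [b y] [c z]; rewrite /null_mul /= mulrA; congr pair.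
by rewrite !mulrzDl addrA -!mulrzA ![_ * c]mulrC ![_ * a]mulrC.
Qed.

Lemma null_mulC : commutative null_mul.
Proof. by move=> [a x] [b y]; rewrite /null_mul /= mulrC addrC. Qed.

Lemma null_mul1 : left_id ((1, 0) : null_ext V) null_mul.
Proof. by move=> [a x]; rewrite /null_mul /= mul1r mulr1z mul0rz addr0. Qed.

Lemma null_mulDl : left_distributive null_mul +%R.
Proof.
move=> [a x] [b y] [c z]; rewrite /null_mul /= mulrDl; congr pair.
by rewrite mulrzDr mulrzDl addrACA.
Qed.

Lemma null_one_neq0 : ((1, 0) : null_ext V) != 0.
Proof. by []. Qed.

HB.instance Definition _ := GRing.Zmodule_isComNzRing.Build (null_ext V)
  null_mulA null_mulC null_mul1 null_mulDl null_one_neq0.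

Definition null_inj (v : V) : null_ext V := (0, v).

Fact null_inj_is_additive : zmod_morphism null_inj.
Proof. by move=> x y; rewrite /null_inj; congr pair; rewrite /= subr0. Qed.

HB.instance Definition _ :=
  GRing.isZmodMorphism.Build V (null_ext V) null_inj null_inj_is_additive.

Lemma null_inj_inj : injective null_inj.
Proof. by move=> x y []. Qed.

(** Used backwards: adds a known relation a = b to the goal l = r, which
    becomes a formal identity once enough relations have been added. *)
Lemma eq_shift (a b l r : V) : a = b -> l + b = r + a -> l = r.
Proof. by move=> -> /addIr. Qed.

End NullExtension.

Ltac zring := apply: null_inj_inj; ring.

(** * Identities of the Peirce space of an idempotent *)

Section CommutativeProduct.
Variables (V : zmodType) (op : V -> V -> V).
Hypotheses (opC : commutative op) (opDr : right_distributive op +%R).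
Hypothesis tors2 : forall v : V, v *+ 2 = 0 -> v = 0.

Local Notation "x ** y" := (op x y) (at level 40, left associativity).

Lemma opDl : left_distributive op +%R.
Proof. by move=> x y z; rewrite ![_ ** z]opC opDr. Qed.

Lemma op0r x : x ** 0 = 0.
Proof. by apply: (@addrI _ (x ** 0)); rewrite -opDr !addr0. Qed.

Lemma op0l x : 0 ** x = 0.
Proof. by rewrite opC op0r. Qed.

Lemma opNr x y : x ** (- y) = - (x ** y).
Proof. by apply: (@addrI _ (x ** y)); rewrite -opDr !subrr op0r. Qed.

Lemma opNl x y : (- x) ** y = - (x ** y).
Proof. by rewrite ![_ ** y]opC opNr. Qed.

Lemma opMnr x y n : x ** (y *+ n) = (x ** y) *+ n.
Proof. by elim: n => [|n IH]; rewrite ?op0r // !mulrS opDr IH. Qed.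

Lemma opMnl x y n : (x *+ n) ** y = (x ** y) *+ n.
Proof. by rewrite ![_ ** y]opC opMnr. Qed.

Definition opE := (opDl, opDr, opNl, opNr, opMnl, opMnr).

(** The next lemmas are stated for a bare biadditive product because they are
    needed both in A and in its dual numbers. *)
Section PeirceOne.
Variable c : V.
Hypothesis c_idem : c ** c = c.
Hypothesis closed1 : forall u v,
  c ** u = u -> c ** v = v -> c ** (u ** v) = u ** v.
Hypothesis pal : forall x, square op (cube op x) = cube op (square op x).

(** Since c is a unit for u and its products, f(c + u) can be expanded as if in a
    unital algebra; the terms of degree at most 3 cancel, and the one of degree 6
    is f(u) = 0. *)
Lemma quartic_plus_quintic u : c ** u = u ->
  let y := u ** u in let w := u ** y in let z := y ** y in
  (z - u ** w) *+ 2 + (y ** w - u ** z) *+ 2 = 0.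
Proof.
move=> cu y w z.
have cy : c ** y = y by apply: closed1.
have cw : c ** w = w by apply: closed1.
have cz : c ** z = z by apply: closed1.
have q1 : square op (c + u) = c + u *+ 2 + y.
  by rewrite /square !opE c_idem (opC u c) cu -/y; zring.
have p1 : cube op (c + u) = c + u *+ 3 + y *+ 3 + w.
  rewrite /cube q1 !opE (opC u c) c_idem cu cy -/y -/w; zring.
have q2 : square op (c + u *+ 2 + y) = c + u *+ 4 + y *+ 6 + w *+ 4 + z.
  rewrite /square !opE (opC u c) (opC y c) (opC y u) c_idem cu cy -/y -/w -/z.
  zring.
have fu : w ** w = y ** z by have := pal u; rewrite /cube /square -/y -/w -/z.
have := pal (c + u); rewrite q1 p1 /cube q2 /square.
rewrite !opE !(opC u c, opC y c, opC w c, opC y u, opC w u, opC w y).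
rewrite c_idem cu cy cw cz -/y -/w -/z fu => fcu.
apply: (eq_shift fcu); zring.
Qed.

(** The substitution u -> -u fixes the quartic bracket and changes the sign of the
    quintic one. *)
Lemma quartic_quintic u : c ** u = u ->
  (u ** u) ** (u ** u) = u ** (u ** (u ** u)) /\
  (u ** u) ** (u ** (u ** u)) = u ** ((u ** u) ** (u ** u)).
Proof.
move=> cu; have := quartic_plus_quintic cu.
have /quartic_plus_quintic /= : c ** (- u) = - u by rewrite opNr cu.
rewrite !opE !opprK => minus plus.
split; apply/subr0_eq/tors2/tors2; apply: (eq_shift plus).
  by apply: (eq_shift minus); zring.
by apply: (eq_shift (esym minus)); zring.
Qed.

End PeirceOne.

(** * Powers of an element of the Peirce space *)

(** [quartic1] and [quintic1] are the parts of degree 1 in y of the identities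
    x^2 x^2 = x x^3 and x^2 x^3 = x (x^2 x^2) at x + y. *)
Section Powers.
Variable B : V -> Prop.
Hypothesis B_add : forall x y, B x -> B y -> B (x + y).
Hypothesis B_opp : forall x, B x -> B (- x).
Hypothesis B_mul : forall x y, B x -> B y -> B (x ** y).
Hypothesis quartic1 : forall x y, B x -> B y ->
  ((x ** x) ** (x ** y)) *+ 4 =
  y ** (x ** (x ** x)) + x ** (y ** (x ** x)) + (x ** (x ** (x ** y))) *+ 2.
Hypothesis quintic1 : forall x y, B x -> B y ->
  ((x ** y) ** (x ** (x ** x))) *+ 2 +
  (x ** x) ** (y ** (x ** x)) + ((x ** x) ** (x ** (x ** y))) *+ 2 =
  y ** ((x ** x) ** (x ** x)) + (x ** ((x ** x) ** (x ** y))) *+ 4.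

(** The part of degree 1 in z of [quartic1] at x + z.  Subtracting the identity
    at x - z from the one at x + z leaves twice the parts of odd degree 1 and 3 in
    z, and the latter is [quartic1] at z; so one division by 2 is enough, whatever
    the size of the field. *)
Lemma quartic2 x y z : B x -> B y -> B z ->
  ((x ** x) ** (z ** y)) *+ 4 + ((x ** z) ** (x ** y)) *+ 8 =
  y ** (z ** (x ** x)) + (y ** (x ** (x ** z))) *+ 2 +
  z ** (y ** (x ** x)) + (x ** (y ** (x ** z))) *+ 2 +
  (z ** (x ** (x ** y)) + x ** (z ** (x ** y)) + x ** (x ** (z ** y))) *+ 2.
Proof.
move=> Bx By Bz; apply/subr0_eq/tors2.
have := quartic1 (B_add Bx Bz) By; have := quartic1 (B_add Bx (B_opp Bz)) By.
rewrite !opE !(opC z x) => Em Ep; have Ez := quartic1 Bz By.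
apply: (eq_shift Ep); apply: (eq_shift (esym Em)).
by apply: (eq_shift (esym Ez)); apply: (eq_shift (esym Ez)); zring.
Qed.

Variable c : V.
Hypothesis Bc : B c.
Hypothesis cB : forall x, B x -> c ** x = x.
Hypothesis pal : forall x, square op (cube op x) = cube op (square op x).
Hypothesis tors3 : (forall v : V, v *+ 3 = 0) \/ (forall v : V, v *+ 3 = 0 -> v = 0).
Hypothesis quartic : forall x, B x -> (x ** x) ** (x ** x) = x ** (x ** (x ** x)).
Hypothesis quintic : forall x, B x ->
  (x ** x) ** (x ** (x ** x)) = x ** ((x ** x) ** (x ** x)).

Variable x : V.
Hypothesis Bx : B x.

(** The powers of x; c serves as the power of exponent 0. *)
Definition pw n := iter n (op x) c.

Lemma pw_in n : B (pw n).
Proof. by elim: n => [|n IH] //=; apply: B_mul. Qed.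

Lemma pw0l a : pw 0 ** pw a = pw a.
Proof. exact/cB/pw_in. Qed.

Lemma pw1 : pw 1 = x.
Proof. by rewrite /= opC cB. Qed.

Lemma pw1l a : pw 1 ** pw a = pw a.+1.
Proof. by rewrite pw1. Qed.

Definition defect n k := pw k ** pw (n - k) - pw n.

(** In degree n all products of powers of lower total degree are known to be right,
    so an identity evaluated at powers relates only its outermost products. *)
Section Degree.
Variable n : nat.
Hypothesis lower : forall i j, (i + j < n)%N -> pw i ** pw j = pw (i + j).
Local Notation d := (defect n).

Lemma defect0 : d 0 = 0.
Proof. by rewrite /defect pw0l subn0 subrr. Qed.

Lemma defect1 : (0 < n)%N -> d 1 = 0.
Proof. by case: n => // m _; rewrite /defect pw1l subn1 subrr. Qed.

Lemma defect_sym i j : (i + j)%N = n -> d i = d j.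
Proof. by move=> E; rewrite /defect -E addnK addKn opC. Qed.

Lemma pw_mul_defect i j : (i + j)%N = n -> pw i ** pw j = pw n + d i.
Proof. by move=> E; rewrite /defect -{2}E addKn; zring. Qed.

(** [quartic1] at x^i and x^l. *)
Lemma defect_quartic1 i l : (0 < i)%N -> (0 < l)%N -> (i * 3 + l)%N = n ->
  d (i * 2) *+ 4 = d (i * 3) + d i *+ 3.
Proof.
move=> i0 l0 E; have := quartic1 (pw_in i) (pw_in l).
rewrite (lower (i := i) (j := i)); last lia.
rewrite (lower (i := i) (j := l)); last lia.
rewrite (lower (i := i) (j := i + i)); last lia.
rewrite (lower (i := l) (j := i + i)); last lia.
rewrite (lower (i := i) (j := i + l)); last lia.
rewrite !pw_mul_defect; try lia.
rewrite (@defect_sym l (i * 3)); last lia.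
rewrite (_ : i + i = i * 2)%N; last lia.
move=> H; apply: (eq_shift H); zring.
Qed.

(** [quartic2] at x^i, x^j and x^k. *)
Lemma defect_quartic2 i j k : (0 < i)%N -> (0 < j)%N -> (0 < k)%N ->
  (i * 2 + j + k)%N = n ->
  d (i * 2) *+ 4 + d (i + j) *+ 8 = d i *+ 6 + d j *+ 3 + d k *+ 3.
Proof.
move=> i0 j0 k0 E; have := quartic2 (pw_in i) (pw_in k) (pw_in j).
rewrite (lower (i := i) (j := i)); last lia.
rewrite (lower (i := i) (j := j)); last lia.
rewrite (lower (i := i) (j := k)); last lia.
rewrite (lower (i := j) (j := k)); last lia.
rewrite (lower (i := j) (j := i + i)); last lia.
rewrite (lower (i := k) (j := i + i)); last lia.
rewrite (lower (i := i) (j := i + j)); last lia.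
rewrite (lower (i := i) (j := i + k)); last lia.
rewrite (lower (i := j) (j := i + k)); last lia.
rewrite (lower (i := k) (j := i + j)); last lia.
rewrite (lower (i := i) (j := j + k)); last lia.
rewrite !pw_mul_defect; try lia.
rewrite (_ : i + i = i * 2)%N; last lia.
move=> H; apply: (eq_shift H); zring.
Qed.

(** [quintic1] at x and x^(n-4).  In characteristic 3 all relations of
    [defect_quartic2] allow d_2 = d_3 = ... = d_(n-2) to be nonzero; this one does
    not. *)
Lemma defect_quintic1 : (4 < n)%N -> d 3 *+ 2 + d 2 *+ 3 = d 4.
Proof.
move=> n4; set l := (n - 4)%N; have := quintic1 (pw_in 1) (pw_in l).
rewrite (lower (i := 1) (j := 1)); last lia.
rewrite (lower (i := 1) (j := l)); last lia.
rewrite (lower (i := 1) (j := 1 + 1)); last lia.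
rewrite (lower (i := l) (j := 1 + 1)); last lia.
rewrite (lower (i := 1) (j := 1 + l)); last lia.
rewrite (lower (i := 1 + 1) (j := 1 + 1)); last lia.
rewrite (lower (i := 1 + 1) (j := 1 + l)); last lia.
rewrite !pw_mul_defect; try lia.
rewrite (@defect_sym l 4); last lia.
rewrite (@defect_sym (1 + l) 3); last lia.
rewrite (_ : 1 + 1 = 2)%N // defect1; last lia.
move=> H; apply: (eq_shift H); zring.
Qed.

Lemma defect2_eq0 : (3 < n)%N -> d 2 = 0.
Proof.
move=> n3; have d1 : d 1 = 0 by apply: defect1; lia.
have [n4|n4] := leqP n 4.
  have -> : n = 4%N by lia.
  by have := quartic (pw_in 1); rewrite !pw1l /defect => ->; rewrite subrr.
have [n5|n5] := leqP n 5.
  have -> : n = 5%N by lia.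
  have := quintic (pw_in 1); rewrite !pw1l /defect => ->.
  have := quartic (pw_in 1); rewrite !pw1l => ->.
  by rewrite !pw1l subrr.
have d3 : d 3 = d 2 *+ 4.
  have E := @defect_quartic1 1 (n - 3) isT ltac:(lia) ltac:(lia).
  by apply: (eq_shift (esym E)); rewrite !mul1n d1; zring.
have d4 : d 4 = d 2 *+ 11 by rewrite -defect_quintic1 ?d3; [zring | lia].
have d5 : d 5 *+ 3 = d 2 *+ 80.
  have E := @defect_quartic2 1 3 (n - 5) isT isT ltac:(lia) ltac:(lia).
  rewrite (@defect_sym (n - 5) 5) in E; last lia.
  by apply: (eq_shift (esym E)); rewrite !mul1n !add1n d1 d3 d4; zring.
have d5' : d 5 *+ 3 = d 2 *+ 70.
  have E := @defect_quartic2 2 1 (n - 5) isT isT ltac:(lia) ltac:(lia).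
  rewrite (@defect_sym (n - 5) 5) in E; last lia.
  by apply: (eq_shift (esym E)); rewrite !mul2n addn1 d1 d3 d4; zring.
have d2_10 : d 2 *+ 10 = 0 by apply: (eq_shift (esym d5)); apply: (eq_shift d5'); zring.
have [n6|n6] := leqP n 6.
  (* In degree 6 the identity f(x) = 0 itself says that d_3 = d_2. *)
  have d2_3 : d 2 *+ 3 = 0.
    suff d32 : d 3 = d 2 by apply: (eq_shift d32); rewrite d3; zring.
    have n_eq : n = 6%N by lia.
    rewrite /defect n_eq -[(6 - 3)%N]/3%N -[(6 - 2)%N]/4%N.
    have := pal (pw 1); rewrite /cube /square !pw1l.
    by have := quartic (pw_in 1); rewrite !pw1l => -> ->.
  apply: (eq_shift d2_10); do 3! apply: (eq_shift (esym d2_3)); zring.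
(* With n > 6 the exponent n - 6 is positive, which gives two relations in d_6;
   eliminating d_5 and d_6 leaves 184 d_2 = 0, and gcd(184, 10) = 2. *)
have d6 : d 6 = d 2 *+ 41.
  have E := @defect_quartic1 2 (n - 6) isT ltac:(lia) ltac:(lia).
  by apply: (eq_shift (esym E)); rewrite !mul2n d4; zring.
have d5'' : d 5 *+ 8 = d 2 *+ 152.
  have E := @defect_quartic2 1 4 (n - 6) isT isT ltac:(lia) ltac:(lia).
  rewrite (@defect_sym (n - 6) 6) in E; last lia.
  by apply: (eq_shift E); rewrite !mul1n !add1n d1 d4 d6; zring.
apply: tors2; have d2_184 : d 2 *+ 184 = 0.
  apply: (eq_shift (esym (congr1 (fun v => v *+ 8) d5))).
  by apply: (eq_shift (congr1 (fun v => v *+ 3) d5'')); zring.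
do 2! apply: (eq_shift (esym d2_184)).
by apply: (eq_shift (congr1 (fun v => v *+ 37) d2_10)); zring.
Qed.

(** With d_1 = d_2 = 0, [quartic2] gives 8 d_(k+1) = 3 (d_k + d_(k+2)): this
    is a recurrence if 3 is invertible, and says d_(k+1) = 0 if 3 = 0. *)
Lemma defect_eq0 k : (k <= n)%N -> d k = 0.
Proof.
move=> kn.
wlog k2n : k kn / (k * 2 <= n)%N => [wl|].
  have [|kn2] := leqP (k * 2) n; first exact: wl.
  by rewrite (@defect_sym k (n - k)) ?wl //; lia.
case: (leqP k 1) => [k1|k1].
  by case: k k1 kn k2n => [|[|//]] _ ? ?; [apply: defect0 | apply: defect1].
have d1 : d 1 = 0 by apply: defect1; lia.
have d2 : d 2 = 0 by apply: defect2_eq0; lia.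
have rec j : (0 < j)%N -> (j.+2 < n)%N -> d j.+1 *+ 8 = d j *+ 3 + d j.+2 *+ 3.
  move=> j0 jn.
  have E := @defect_quartic2 1 j (n - j.+2) isT j0 ltac:(lia) ltac:(lia).
  rewrite (@defect_sym (n - j.+2) j.+2) in E; last lia.
  by apply: (eq_shift E); rewrite mul1n add1n d1 d2; zring.
have [three0|tors3'] := tors3.
  case: k kn k2n k1 => [//|[//|j]] kn k2n _.
  apply: tors2; apply: tors2; apply: tors2; rewrite -!mulrnA.
  by rewrite rec ?three0 ?addr0 //; lia.
suff both j : (j.+2 < n)%N -> d j.+1 = 0 /\ d j.+2 = 0.
  by case: k kn k2n k1 => [//|j] kn k2n j1; apply: (both j _).1; lia.
elim: j => [//|j IH] jn; have [dj dj1] := IH ltac:(lia); split=> //.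
apply: tors3'; have := rec j.+1 isT jn; rewrite dj dj1 !mul0rn add0r.
exact: esym.
Qed.

End Degree.

Theorem pwD i j : pw i ** pw j = pw (i + j).
Proof.
have [n] := ubnP (i + j)%N; elim: n => // n IH in i j *.
rewrite ltnS leq_eqVlt => /orP [/eqP E|]; last exact: IH.
have lower a b : (a + b < n)%N -> pw a ** pw b = pw (a + b) by exact: IH.
by rewrite E (pw_mul_defect E) (defect_eq0 lower) ?addr0 //; lia.
Qed.

End Powers.
End CommutativeProduct.

(** * Power series and their values *)

Section Series.
Variables (F : fieldType) (A : lmodType F) (mul : {bilinear A -> A -> A}).
Local Notation "x ** y" := (mul x y) (at level 40, left associativity).
Local Notation "z *s w" := (series_mul mul z w) (at level 40).

Lemma series_mul0 z w : (z *s w) 0%N = z 0%N ** w 0%N.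
Proof. by rewrite /series_mul big_ord1. Qed.

Lemma series_mul1 z w : (z *s w) 1%N = z 0%N ** w 1%N + z 1%N ** w 0%N.
Proof. by rewrite /series_mul !big_ord_recl big_ord0 addr0. Qed.

Lemma series_mul2 z w :
  (z *s w) 2%N = z 0%N ** w 2%N + z 1%N ** w 1%N + z 2%N ** w 0%N.
Proof. by rewrite /series_mul !big_ord_recl big_ord0 addr0 addrA. Qed.

Definition degree_le n (z : nat -> A) := forall i, (n < i)%N -> z i = 0.

Lemma series_mul_lead m n z w : degree_le m z -> degree_le n w ->
  (z *s w) (m + n)%N = z m ** w n.
Proof.
move=> dz dw; rewrite /series_mul.
have mlt : (m < (m + n).+1)%N by rewrite ltnS leq_addr.
rewrite (bigD1 (Ordinal mlt)) //= addKn big1 ?addr0 // => i /eqP ne_im.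
case: (ltngtP i m) => [lt_im|lt_mi|eq_im]; last by case: ne_im; apply: val_inj.
  by rewrite dw ?linear0r //; lia.
by rewrite dz ?linear0l.
Qed.

Lemma degree_le_mul m n z w : degree_le m z -> degree_le n w ->
  degree_le (m + n) (z *s w).
Proof.
move=> dz dw k mnk; rewrite /series_mul big1 // => i _.
have [lt_mi|le_im] := ltnP m i; first by rewrite dz ?linear0l.
by rewrite dw ?linear0r //; lia.
Qed.

Definition eval (z : nat -> A) n (t : F) := \sum_(i < n.+1) t ^+ i *: z i.

Lemma eval_recl z n t : eval z n.+1 t = z 0%N + t *: eval (z \o S) n t.
Proof.
rewrite /eval big_ord_recl expr0 scale1r scaler_sumr; congr (_ + _).
by apply: eq_bigr => i _; rewrite scalerA -exprS.
Qed.

Lemma eval_degree z m n t : degree_le m z -> (m <= n)%N ->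
  eval z n t = eval z m t.
Proof.
move=> dz; elim: n => [|n IH]; first by rewrite leqn0 => /eqP ->.
rewrite leq_eqVlt => /orP [/eqP <- //|mn].
by rewrite /eval big_ord_recr /= (dz n.+1) // scaler0 addr0; apply: IH.
Qed.

Lemma eval_mul m n z w t : degree_le m z -> degree_le n w ->
  eval (z *s w) (m + n) t = eval z m t ** eval w n t.
Proof.
elim: m z => [|m IH] z dz dw.
  rewrite {2}/eval big_ord1 expr0 scale1r linear_sumr; apply: eq_bigr => i _.
  rewrite linearZr_LR /series_mul big_ord_recl /= subn0 big1 ?addr0 // => j _.
  by rewrite dz ?linear0l.
have dz' : degree_le m (z \o S) by move=> i mi; apply: dz.
have dw' : degree_le (m + n).+1 w by move=> i mi; apply: dw; lia.
rewrite addSn eval_recl [eval z _ _]eval_recl linearDl linearZl_LR /= -IH //.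
rewrite -(@eval_degree w n (m + n).+1) //; last lia.
rewrite eval_recl linearDr linearZr_LR /= -addrA -scalerDr series_mul0.
congr (_ + _ *: _); rewrite /eval linear_sumr -big_split /=.
apply: eq_bigr => i _; rewrite linearZr_LR -scalerDr; congr (_ *: _).
by rewrite /series_mul big_ord_recl.
Qed.

Hypothesis char_F : 2%N \notin [pchar F].

Lemma natr_torsion p (v : A) : prime p -> p \notin [pchar F] ->
  v *+ p = 0 -> v = 0.
Proof.
move=> p_pr charFp; rewrite -scaler_nat => /eqP; rewrite scaler_eq0.
by case/orP => [p0|/eqP //]; case/negP: charFp; apply/andP.
Qed.

(** A polynomial t^k (r_k + r_(k+1) t + r_(k+2) t^2 + r_(k+3) t^3) vanishing at
    1, -1, a, -a: the even part of the cubic vanishes at t = 1 and t = a, and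
    these have distinct squares. *)
Lemma lowest_coef_eq0 (a : F) k (r : nat -> A) :
  a != 0 -> a != 1 -> a != -1 -> degree_le (k + 3) r ->
  (forall i, (i < k)%N -> r i = 0) ->
  (forall t, t != 0 -> eval r (k + 3) t = 0) -> r k = 0.
Proof.
move=> a0 a1 aN1; have tors2 v := @natr_torsion 2 v isT char_F.
elim: k r => [|k IH] r dr r_lt r_eval; last first.
  apply: (IH (r \o S)) => [i ki|i ik|t t0]; first exact: dr.
    exact: r_lt.
  have /eqP := r_eval t t0; rewrite eval_recl r_lt // add0r scaler_eq0.
  by rewrite (negPf t0) => /eqP.
have {}r_eval t : t != 0 ->
    r 0%N + t *: r 1%N + t ^+ 2 *: r 2%N + t ^+ 3 *: r 3%N = 0.
  move/r_eval; rewrite /eval -[(0 + 3)%N]/3%N !big_ord_recr big_ord0 /=.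
  by rewrite !expr0 scale1r add0r expr1.
have even t : t != 0 -> r 0%N + t ^+ 2 *: r 2%N = 0.
  move=> t0; apply: tors2.
  have := r_eval _ (etrans (congr1 negb (oppr_eq0 t)) t0).
  rewrite sqrrN (_ : (- t) ^+ 3 = - t ^+ 3); last by ring.
  rewrite !scaleNr => Em; have Ep := r_eval t t0.
  by apply: (eq_shift Ep); apply: (eq_shift Em); zring.
have e1 := even 1 (oner_neq0 _); have ea := even a a0.
rewrite expr1n scale1r in e1; suff r2 : r 2%N = 0 by rewrite r2 addr0 in e1.
have /eqP : (a ^+ 2 - 1) *: r 2%N = 0.
  rewrite scalerBl scale1r; apply: (eq_shift ea).
  by apply: (eq_shift (esym e1)); zring.
by rewrite scaler_eq0 subr_eq0 sqrf_eq1 (negPf a1) (negPf aN1) => /eqP.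
Qed.

(** Agreement of the top coefficients lets four points handle degree k + 4.  The
    field with 5 elements has no further nonzero point. *)
Lemma lowest_coef_eq (a : F) k (s s' : nat -> A) :
  a != 0 -> a != 1 -> a != -1 -> degree_le (k + 4) s -> degree_le (k + 4) s' ->
  s (k + 4)%N = s' (k + 4)%N -> (forall i, (i < k)%N -> s i = s' i) ->
  (forall t, eval s (k + 4) t = eval s' (k + 4) t) -> s k = s' k.
Proof.
move=> a0 a1 aN1 ds ds' top low eqss'; apply/subr0_eq.
have dr : degree_le (k + 3) (fun i => s i - s' i).
  move=> i ik; have [<-|ne] := (k + 4 =P i)%N; first by rewrite top subrr.
  by rewrite ds ?ds' ?subrr //; lia.
apply: (lowest_coef_eq0 a0 a1 aN1 dr) => [i ik|t _]; first by rewrite low ?subrr.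
rewrite -(@eval_degree _ _ (k + 4)%N _ dr) ?leq_add2l //.
transitivity (eval s (k + 4) t - eval s' (k + 4) t); last by rewrite eqss' subrr.
rewrite /eval -sumrB; apply: eq_bigr => i _; exact: scalerBr.
Qed.

(** The line x + t y, as a series in t. *)
Definition lin_series (x y : A) : nat -> A :=
  fun n => match n with 0 => x | 1 => y | _ => 0 end.

Lemma degree_lin x y : degree_le 1 (lin_series x y).
Proof. by move=> [|[|i]]. Qed.

Lemma eval_lin x y t : eval (lin_series x y) 1 t = x + t *: y.
Proof. by rewrite eval_recl /eval big_ord1 scale1r. Qed.

Hypothesis mulC : commutative mul.
Hypothesis palA : palintropic23 mul.
Variable c : A.
Hypothesis c_idem : c ** c = c.

Let mulDr : right_distributive mul +%R.
Proof. by move=> x y z; rewrite linearDr. Qed.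

(** The two sides of the palintropic identity at c + t x: modulo t^3 they differ
    only by t^2 (x^2 - c x^2). *)
Lemma square_coef x : c ** x = x ->
  let z := lin_series c x in
  let s := square (series_mul mul) (cube (series_mul mul) z) in
  let s' := cube (series_mul mul) (square (series_mul mul) z) in
  [/\ s 0%N = s' 0%N, s 1%N = s' 1%N
    & s 2%N = s' 2%N -> c ** (x ** x) = x ** x].
Proof.
move=> cx z; rewrite /cube /square !series_mul2 !series_mul1 !series_mul0 /=.
rewrite !linear0r !linear0l !addr0 !add0r.
rewrite !(opE mulC mulDr, c_idem, cx, mulC x c).
split=> [//||E]; first by zring.
apply: (eq_shift (esym E)).
rewrite !(mulC (x ** x) c) !(mulC (c ** (x ** x)) c); zring.
Qed.

(** * The Peirce space is a subalgebra and satisfies the linearized identities *)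

Local Notation B := (peirce1 mul c).
Hypothesis strict_or_large : strictly_palintropic23 mul \/
  exists a : F, [/\ a != 0, a != 1 & a != -1].

Let tors2 (v : A) : v *+ 2 = 0 -> v = 0.
Proof. exact: natr_torsion char_F. Qed.

(** Over a large field, f vanishes on the line c + t x; its coefficients in degrees
    0, 1 and 6 cancel (the last one is f(x)), so the coefficient in degree 2 can be
    isolated. *)
Lemma peirce1_square x : B x -> B (x ** x).
Proof.
rewrite /peirce1 => cx; have [eq0 eq1] := square_coef cx; apply.
have [strict|[a [a0 a1 aN1]]] := strict_or_large; first exact: strict.
set z := lin_series c x; have dz : degree_le 1 z := @degree_lin c x.
have dq := degree_le_mul dz dz; have dp := degree_le_mul dz dq.
have dqq := degree_le_mul dq dq.
apply: (lowest_coef_eq (k := 2) a0 a1 aN1).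
- exact: (degree_le_mul dp dp).
- exact: (degree_le_mul dq dqq).
- transitivity (square mul (cube mul x)).
    by rewrite [LHS](series_mul_lead dp dp) (series_mul_lead dz dq)
      (series_mul_lead dz dz).
  rewrite palA /cube /square; symmetry.
  by rewrite [LHS](series_mul_lead dq dqq) (series_mul_lead dq dq)
    (series_mul_lead dz dz).
- by case=> [|[|]].
move=> t; rewrite [LHS](eval_mul t dp dp) [RHS](eval_mul t dq dqq).
rewrite (eval_mul t dz dq) (eval_mul t dq dq) (eval_mul t dz dz); exact: palA.
Qed.

Lemma peirce1_add x y : B x -> B y -> B (x + y).
Proof. by rewrite /peirce1 linearDr => -> ->. Qed.

Lemma peirce1_scale a x : B x -> B (a *: x).
Proof. by rewrite /peirce1 linearZr_LR => ->. Qed.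

Lemma peirce1_opp x : B x -> B (- x).
Proof. by rewrite /peirce1 linearNr => ->. Qed.

Lemma peirce1_mul x y : B x -> B y -> B (x ** y).
Proof.
move=> Bx By; have := peirce1_square (peirce1_add Bx By).
have := peirce1_square Bx; have := peirce1_square By.
rewrite /peirce1 !(opE mulC mulDr) (mulC y x) => sy sx sxy.
apply/subr0_eq/tors2; apply: (eq_shift sxy); apply: (eq_shift (esym sx)).
by apply: (eq_shift (esym sy)); zring.
Qed.

Lemma peirce1_subalgebra : subalgebra mul B.
Proof.
split; [by rewrite /peirce1 linear0r | exact: peirce1_add
      | exact: peirce1_scale | exact: peirce1_mul].
Qed.

Let pal x : square mul (cube mul x) = cube mul (square mul x) := palA x.

Lemma peirce1_quartic x : B x -> (x ** x) ** (x ** x) = x ** (x ** (x ** x)).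
Proof.
by move=> Bx; case: (quartic_quintic mulC mulDr tors2 c_idem peirce1_mul pal Bx).
Qed.

Lemma peirce1_quintic x : B x ->
  (x ** x) ** (x ** (x ** x)) = x ** ((x ** x) ** (x ** x)).
Proof.
by move=> Bx; case: (quartic_quintic mulC mulDr tors2 c_idem peirce1_mul pal Bx).
Qed.

(** The product of the dual numbers A[t]/(t^2), with (a, b) standing for a + t b. *)
Definition dual_mul (p q : A * A) : A * A :=
  (p.1 ** q.1, p.1 ** q.2 + p.2 ** q.1).

(** A[t]/(t^2) is a quotient of A[[t]], so the strict identity passes to it, and
    the Peirce space of its idempotent c consists of the dual numbers over B. *)
Lemma dual_quartic_quintic p : strictly_palintropic23 mul -> B p.1 -> B p.2 ->
  dual_mul (dual_mul p p) (dual_mul p p) =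
    dual_mul p (dual_mul p (dual_mul p p)) /\
  dual_mul (dual_mul p p) (dual_mul p (dual_mul p p)) =
    dual_mul p (dual_mul (dual_mul p p) (dual_mul p p)).
Proof.
move=> strict Bp1 Bp2.
have unitE q : dual_mul (c, 0) q = q <-> B q.1 /\ B q.2.
  case: q => a b; rewrite /dual_mul /= linear0l addr0.
  by split=> [[]|[-> ->]].
apply: (@quartic_quintic _ dual_mul _ _ _ (c, 0)).
- by move=> u v; rewrite /dual_mul !(mulC v.1) !(mulC v.2) addrC.
- move=> u v w; rewrite /dual_mul /= !linearDr; congr pair.
  by rewrite addrACA.
- by move=> [a b] [/tors2 -> /tors2 ->].
- by apply/unitE; rewrite /peirce1 /= linear0r.
- move=> u v /unitE [? ?] /unitE [? ?]; apply/unitE; split.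
    exact: peirce1_mul.
  by apply: peirce1_add; apply: peirce1_mul.
- pose trunc (z : nat -> A) := (z 0%N, z 1%N).
  have truncM z w : trunc (z *s w) = dual_mul (trunc z) (trunc w).
    by rewrite /trunc series_mul0 series_mul1.
  move=> u; have uE : u = trunc (lin_series u.1 u.2) by case: u.
  rewrite uE /square /cube /square -!truncM /trunc.
  by have := strict (lin_series u.1 u.2); rewrite /square /cube /square => S; rewrite !S.
by apply/unitE.
Qed.

(** The coefficient of t in the quartic identity at x + t y, extracted in dual
    numbers or by evaluation; [peirce1_quintic1] is analogous. *)
Lemma peirce1_quartic1 x y : B x -> B y ->
  ((x ** x) ** (x ** y)) *+ 4 =
  y ** (x ** (x ** x)) + x ** (y ** (x ** x)) + (x ** (x ** (x ** y))) *+ 2.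
Proof.
move=> Bx By.
set z := lin_series x y; pose q := z *s z; pose s := q *s q.
pose s' := z *s (z *s q).
suff : s 1%N = s' 1%N.
  rewrite /s /s' /q !series_mul1 !series_mul0 /= !(opE mulC mulDr).
  rewrite (mulC y x) (mulC (x ** y) (x ** x)) => E.
  by apply: (eq_shift E); zring.
have [strict|[a [a0 a1 aN1]]] := strict_or_large.
  have [E _] := @dual_quartic_quintic (x, y) strict Bx By.
  have /= := congr1 snd E.
  by rewrite /s /s' /q !series_mul1 !series_mul0.
have dz : degree_le 1 z := @degree_lin x y; have dq := degree_le_mul dz dz.
have dzq := degree_le_mul dz dq.
have ds : degree_le 4 s := degree_le_mul dq dq.
have ds' : degree_le 4 s' := degree_le_mul dz dzq.
apply: (lowest_coef_eq (k := 1) a0 a1 aN1).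
- by move=> i ?; apply: ds; lia.
- by move=> i ?; apply: ds'; lia.
- by rewrite ds ?ds'.
- case=> // _; rewrite /s /s' /q !series_mul0; exact: peirce1_quartic.
move=> t; rewrite -[(1 + 4)%N]/5%N (eval_degree t ds) // (eval_degree t ds') //.
rewrite [LHS](eval_mul t dq dq) [RHS](eval_mul t dz dzq) (eval_mul t dz dq).
rewrite (eval_mul t dz dz) eval_lin.
by apply: peirce1_quartic; apply: peirce1_add => //; apply: peirce1_scale.
Qed.

Lemma peirce1_quintic1 x y : B x -> B y ->
  ((x ** y) ** (x ** (x ** x))) *+ 2 +
  (x ** x) ** (y ** (x ** x)) + ((x ** x) ** (x ** (x ** y))) *+ 2 =
  y ** ((x ** x) ** (x ** x)) + (x ** ((x ** x) ** (x ** y))) *+ 4.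
Proof.
move=> Bx By.
set z := lin_series x y; pose q := z *s z; pose s := q *s (z *s q).
pose s' := z *s (q *s q).
suff : s 1%N = s' 1%N.
  rewrite /s /s' /q !series_mul1 !series_mul0 /= !(opE mulC mulDr).
  rewrite (mulC y x) (mulC (x ** y) (x ** x)) => E.
  by apply: (eq_shift E); zring.
have [strict|[a [a0 a1 aN1]]] := strict_or_large.
  have [_ E] := @dual_quartic_quintic (x, y) strict Bx By.
  have /= := congr1 snd E.
  by rewrite /s /s' /q !series_mul1 !series_mul0.
have dz : degree_le 1 z := @degree_lin x y; have dq := degree_le_mul dz dz.
have dzq := degree_le_mul dz dq; have dqq := degree_le_mul dq dq.
apply: (lowest_coef_eq (k := 1) a0 a1 aN1).
- exact: degree_le_mul dq dzq.
- exact: degree_le_mul dz dqq.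
- rewrite [LHS](series_mul_lead dq dzq) [RHS](series_mul_lead dz dqq).
  rewrite (series_mul_lead dz dq) (series_mul_lead dq dq) (series_mul_lead dz dz).
  exact: peirce1_quintic.
- case=> // _; rewrite /s /s' /q !series_mul0; exact: peirce1_quintic.
move=> t; rewrite [LHS](eval_mul t dq dzq) [RHS](eval_mul t dz dqq).
rewrite (eval_mul t dz dq) (eval_mul t dq dq) (eval_mul t dz dz) eval_lin.
by apply: peirce1_quintic; apply: peirce1_add => //; apply: peirce1_scale.
Qed.

Lemma peirce1_pwD x : B x -> forall i j,
  pw mul c x i ** pw mul c x j = pw mul c x (i + j).
Proof.
move=> Bx.
have tors3 : (forall v : A, v *+ 3 = 0) \/ (forall v : A, v *+ 3 = 0 -> v = 0).
  have [F3|nF3] := boolP (3%N \in [pchar F]).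
    by left=> v; rewrite -scaler_nat (pcharf0 F3) scale0r.
  by right=> v; apply: natr_torsion.
exact: (pwD mulC mulDr tors2 peirce1_add peirce1_opp peirce1_mul peirce1_quartic1
  peirce1_quintic1 c_idem (fun x (Bx : B x) => Bx) pal tors3 peirce1_quartic
  peirce1_quintic Bx).
Qed.

(** * Power-associativity *)

Definition subspace (S : A -> Prop) : Prop :=
  [/\ S 0, forall x y, S x -> S y -> S (x + y)
    & forall (a : F) x, S x -> S (a *: x)].

(** The span of the family as an intersection of subspaces: multilinear statements
    about it then reduce to the members of the family, one argument at a time. *)
Definition span (e : nat -> A) (y : A) : Prop :=
  forall S, subspace S -> (forall i, S (e i)) -> S y.

Lemma span_subspace e : subspace (span e).
Proof.
split=> [S [S0 _ _] _ //|x y ex ey S sS Se|a x ex S sS Se]; case: (sS) => _ SD SZ.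
  by apply: SD; [apply: ex | apply: ey].
by apply: SZ; apply: ex.
Qed.

Lemma span_mul_mono e x y : (forall i j, e i ** e j = e (i + j)%N) ->
  span e x -> span e y -> span e (x ** y).
Proof.
move=> eD ex ey; have [s0 sD sZ] := span_subspace e.
apply: (ex (fun x => span e (x ** y))) => [|i].
  split=> [|u v|a u]; rewrite ?linear0l ?linearDl ?linearZl_LR //; [exact: sD | exact: sZ].
apply: (ey (fun y => span e (e i ** y))) => [|j].
  split=> [|u v|a u]; rewrite ?linear0r ?linearDr ?linearZr_LR //; [exact: sD | exact: sZ].
by rewrite eD => S _; apply.
Qed.

Lemma span_associative e : (forall i j, e i ** e j = e (i + j)%N) ->
  associative_on mul (span e).
Proof.
move=> eD u v w eu ev ew.
apply: (eu (fun u => u ** (v ** w) = (u ** v) ** w)) => [|i].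
  split=> [|x y|a x]; first by rewrite !linear0l.
    by rewrite !linearDl => -> ->.
  by rewrite !linearZl_LR => ->.
apply: (ev (fun v => e i ** (v ** w) = (e i ** v) ** w)) => [|j].
  split=> [|x y|a x]; first by rewrite !(linear0l, linear0r).
    by rewrite !(linearDl, linearDr) => -> ->.
  by rewrite !(linearZl_LR, linearZr_LR) => ->.
apply: (ew (fun w => e i ** (e j ** w) = (e i ** e j) ** w)) => [|k].
  split=> [|x y|a x]; first by rewrite !linear0r.
    by rewrite !linearDr => -> ->.
  by rewrite !linearZr_LR => ->.
by rewrite !eD addnA.
Qed.

Lemma peirce1_power_associative : power_associative_on mul B.
Proof.
move=> x Bx; have eD := peirce1_pwD Bx.
have [s0 sD sZ] := span_subspace (pw mul c x).
have gen_span y : generated mul x y -> span (pw mul c x) y.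
  apply; first by split=> // u v; exact: span_mul_mono.
  by move=> S _ /(_ 1%N); rewrite /= mulC Bx.
move=> u v w /gen_span su /gen_span sv /gen_span sw.
exact: (span_associative eD).
Qed.

End Series.

Theorem corollary6p5 (F : fieldType) (A : lmodType F)
    (mul : {bilinear A -> A -> A}) (c : A)
    (char_F : 2%N \notin [pchar F])
    (mulC : commutative mul)
    (palA : palintropic23 mul)
    (palA_F3 : (forall a : F, [\/ a = 0, a = 1 | a = -1]) ->
               strictly_palintropic23 mul)
    (c_idem : idempotent_elt mul c)
    (c_neq0 : c != 0) :
  subalgebra mul (peirce1 mul c) /\ power_associative_on mul (peirce1 mul c).
Proof.
have strict_or_large : strictly_palintropic23 mul \/
    exists a : F, [/\ a != 0, a != 1 & a != -1].
  have [large|small] := classic (exists a : F, [/\ a != 0, a != 1 & a != -1]).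
    by right.
  left; apply: palA_F3 => a; have [->|a0] := eqVneq a 0; first by constructor 1.
  have [->|a1] := eqVneq a 1; first by constructor 2.
  have [->|aN1] := eqVneq a (-1); first by constructor 3.
  by case: small; exists a.
split; first exact: peirce1_subalgebra.
exact: peirce1_power_associative.
Qed.
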